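(* Let $n$ be a positive integer and let $r=q^l$, where $q$ is a prime and $l\ge 1$ is an integer. Then $p_r(n) \ge p_r(n+1)$.
   Context: For positive integers $r\ge 2$ and $n$, $p_r(n)$ denotes the probability that a uniformly random permutation $\sigma$ of $[n]=\{1,\dots,n\}$ has an $r$-th root, i.e. $p_r(n)=\frac{1}{n!}\,\left|\{\sigma\in S_n : \exists\, \pi\in S_n,\ \pi^r=\sigma\}\right|$, where $S_n$ is the set of permutations of $[n]$. *)

(* Defs.v *)
From mathcomp Require Import all_boot all_order all_algebra all_fingroup.

Set Implicit Arguments.
Unset Strict Implicit.
Unset Printing Implicit Defensive.

Definition has_root (r n : nat) (s : 'S_n) : bool :=
  [exists t : 'S_n, (t ^+ r)%g == s].

Definition root_prob (r n : nat) : rat :=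
  (#|[set s : 'S_n | has_root r s]|%:R / (n`!)%:R)%R.

(* Main.v *)
(* For r = q^l, a permutation has an r-th root iff for every length c divisible
   by q the number of its c-cycles is divisible by r.  Deleting the cycle
   through a fixed point shows that cycle types of uniform permutations obey
   n f(n, Q) = sum_(1 <= c <= n) f(n - c, Q(c :: _)), f being the mean of a
   statistic Q of the cycle type.  From this recursion alone:
   - the probability p(n) of having an r-th root is the convolution of a(i), the
     probability that no cycle length is divisible by q, and s(j), the
     probability that all of them are and every multiplicity is divisible by r;
   - a(n+1) = a(n) if q does not divide n+1, and n/(n+1) a(n) otherwise;
   - (Markov's inequality for the number of r-subsets of c-cycles)
     n s(n) <= sum over c of s(n - rc) / (c^(r-1) (r-1)!), so s(n) = O(1/n^2).
   As a is nonincreasing and s is nonnegative, p(n+1) <= p(n) follows from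
   a(n+1) + s(n+1) <= a(n), i.e. from (n+1) s(n+1) <= a(n) when q divides n+1;
   the left side is O(1/n) and the right side is of order n^(-1/q).  The
   constants suffice except for r = 2 and n+1 = 4, 8, 12, which are computed. *)

Require Import Defs.
From mathcomp Require Import all_boot all_order all_algebra all_fingroup.
From mathcomp Require Import ring lra zify.

Set Implicit Arguments.
Unset Strict Implicit.
Unset Printing Implicit Defensive.

Import Order.TTheory GRing.Theory Num.Theory.

Local Open Scope ring_scope.

(** * Means over the cycle type of a random permutation *)

Fixpoint cmean_rec (k n : nat) (Q : seq nat -> rat) : rat :=
  if k isn't k'.+1 then 0 else
  if n == 0%N then Q [::] else
  n%:R^-1 * \sum_(1 <= c < n.+1) cmean_rec k' (n - c) (fun u => Q (c :: u)).

(* The mean of [Q] over the list of cycle lengths of a uniform permutation of n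
   points (see [cycle_sumE]); the first argument of [cmean_rec] is fuel. *)
Definition cmean (n : nat) : (seq nat -> rat) -> rat := cmean_rec n.+1 n.

Lemma cmean_rec_fuel k k' n Q :
  (n < k)%N -> (n < k')%N -> cmean_rec k n Q = cmean_rec k' n Q.
Proof.
elim: k k' n Q => [|k IHk] [|k'] n Q //= nk nk'; case: eqVneq => // n0.
congr (_ * _); apply: eq_big_nat => c /andP[c1 cn].
by apply: IHk; lia.
Qed.

Lemma cmean0 Q : cmean 0 Q = Q [::].
Proof. by []. Qed.

Lemma cmean_step n Q :
  (0 < n)%N ->
  n%:R * cmean n Q = \sum_(1 <= c < n.+1) cmean (n - c) (fun u => Q (c :: u)).
Proof.
move=> n0; have -> : cmean n Q = n%:R^-1 * \sum_(1 <= c < n.+1)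
    cmean_rec n (n - c) (fun u => Q (c :: u)) by case: n n0.
rewrite mulrA divff ?mul1r ?pnatr_eq0 -?lt0n //.
by apply: eq_big_nat => c /andP[c1 cn]; apply: cmean_rec_fuel; lia.
Qed.

(* Otherwise unification evaluates [cmean] at concrete n. *)
Opaque cmean.

Lemma eq_cmean n P Q : P =1 Q -> cmean n P = cmean n Q.
Proof.
elim/ltn_ind: n P Q => n IHn P Q PQ; case: (posnP n) => [->|n0].
  by rewrite !cmean0 PQ.
have nz : n%:R != 0 :> rat by rewrite pnatr_eq0 -lt0n.
apply: (mulfI nz); rewrite !cmean_step //.
by apply: eq_big_nat => c /andP[c1 cn]; apply: IHn => [|u]; [lia|rewrite PQ].
Qed.

Lemma cmeanD n P Q : cmean n (fun u => P u + Q u) = cmean n P + cmean n Q.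
Proof.
elim/ltn_ind: n P Q => n IHn P Q; case: (posnP n) => [->|n0].
  by rewrite !cmean0.
have nz : n%:R != 0 :> rat by rewrite pnatr_eq0 -lt0n.
apply: (mulfI nz); rewrite mulrDr !cmean_step // -big_split /=.
by apply: eq_big_nat => c /andP[c1 cn]; rewrite IHn //; lia.
Qed.

Lemma cmeanZ n a Q : cmean n (fun u => a * Q u) = a * cmean n Q.
Proof.
elim/ltn_ind: n Q => n IHn Q; case: (posnP n) => [->|n0].
  by rewrite !cmean0.
have nz : n%:R != 0 :> rat by rewrite pnatr_eq0 -lt0n.
apply: (mulfI nz); rewrite mulrCA !cmean_step // mulr_sumr.
by apply: eq_big_nat => c /andP[c1 cn]; rewrite IHn //; lia.
Qed.

Lemma cmean_const0 n : cmean n (fun=> 0) = 0.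
Proof.
rewrite -[RHS](mul0r (cmean n (fun=> 0))) -cmeanZ.
by apply: eq_cmean => u; rewrite mul0r.
Qed.

Lemma ler_cmean n P Q : (forall u, P u <= Q u) -> cmean n P <= cmean n Q.
Proof.
elim/ltn_ind: n P Q => n IHn P Q PQ; case: (posnP n) => [->|n0].
  by rewrite !cmean0.
have nz : 0 < n%:R :> rat by rewrite ltr0n.
rewrite -(ler_pM2l nz) !cmean_step // !big_nat.
by apply: ler_sum => c /andP[c1 cn]; apply: IHn => //; lia.
Qed.

Lemma cmean_ge0 n Q : (forall u, 0 <= Q u) -> 0 <= cmean n Q.
Proof. by move=> Q0; rewrite -(cmean_const0 n); apply: ler_cmean. Qed.

Definition perm_eq_fun (Q : seq nat -> rat) :=
  forall u v, perm_eq u v -> Q u = Q v.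

Lemma perm_eq_fun_cons c Q : perm_eq_fun Q -> perm_eq_fun (fun u => Q (c :: u)).
Proof. by move=> QP u v uv; apply: QP; rewrite perm_cons. Qed.

(** Marking one c-cycle: by induction, the first length drawn is either the marked one, with weight
    c, or another one, with total weight n - c by the recursion at n - c; the weights add up to n.
    Symmetry of [Q] lets the two lengths trade places. *)
Lemma cmean_count n c Q :
  (0 < c)%N -> perm_eq_fun Q ->
  c%:R * cmean n (fun u => Q u * (count_mem c u)%:R) =
  if (c <= n)%N then cmean (n - c) (fun u => Q (c :: u)) else 0.
Proof.
move=> c0; elim/ltn_ind: n Q => n IHn Q QP; case: (posnP n) => [->|n0].
  by rewrite cmean0 /= leqNgt c0 /= !mulr0.
have nz : n%:R != 0 :> rat by rewrite pnatr_eq0 -lt0n.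
apply: (mulfI nz); rewrite mulrCA cmean_step // mulr_sumr.
pose F d := (if (c <= n - d)%N
             then cmean (n - d - c) (fun u => Q [:: d, c & u]) else 0)
  + (if d == c then c%:R * cmean (n - c) (fun u => Q (c :: u)) else 0).
rewrite (eq_big_nat _ _ (F2 := F)); last first.
  move=> d /andP[d1 dn]; rewrite /F.
  rewrite -(IHn _ _ (fun u => Q (d :: u))); [|lia|exact: perm_eq_fun_cons].
  rewrite (_ : (if d == c then _ else _) =
    c%:R * cmean (n - d) (fun u => (d == c)%:R * Q (d :: u))); last first.
    rewrite cmeanZ; case: eqVneq => [->|_]; first by rewrite mul1r.
    by rewrite mul0r mulr0.
  rewrite -mulrDr -cmeanD; congr (_ * _); apply: eq_cmean => u /=.
  by rewrite natrD; ring.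
rewrite /F big_split /=; case: leqP => cn; last first.
  rewrite !big1_seq ?addr0 ?mulr0 // => d; rewrite mem_index_iota /=;
    by case: ifP => //; lia.
have -> : \sum_(1 <= d < n.+1) (if d == c then
    c%:R * cmean (n - c) (fun u => Q (c :: u)) else 0) =
  c%:R * cmean (n - c) (fun u => Q (c :: u)).
  rewrite -big_mkcond /= big_nat1_eq; case: ifP => //; lia.
have -> : \sum_(1 <= d < n.+1) (if (c <= n - d)%N then
   cmean (n - d - c) (fun u => Q [:: d, c & u]) else 0) =
  (n - c)%:R * cmean (n - c) (fun u => Q (c :: u)).
  rewrite (big_cat_nat (n := (n - c).+1)) /=; [|lia|lia].
  rewrite [X in _ + X]big1_seq ?addr0; last first.
    by move=> d; rewrite mem_index_iota; case: ifP => //; lia.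
  case: (posnP (n - c)%N) => [->|nc0]; first by rewrite big_geq // mul0r.
  rewrite cmean_step //; apply: eq_big_nat => d dn.
  have -> : (c <= n - d)%N by lia.
  rewrite subnAC; apply: eq_cmean => u; apply: QP.
  by rewrite -(cat1s d) -(cat1s c) perm_catCA.
by rewrite -mulrDl -natrD subnK.
Qed.

(* The exponential generating functions over the two kinds of lengths multiply. *)
Lemma cmean_split n (p : pred nat) (B : seq nat -> rat) :
  cmean n (fun u => B (filter (predC p) u)) =
  \sum_(i < n.+1) cmean i (fun u => (all p u)%:R)
    * cmean (n - i) (fun u => (all (predC p) u)%:R * B u).
Proof.
elim/ltn_ind: n B => n IHn B; case: (posnP n) => [->|n0].
  by rewrite big_ord_recl big_ord0 addr0 !cmean0 /= !mul1r.
have nz : n%:R != 0 :> rat by rewrite pnatr_eq0 -lt0n.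
pose a i := cmean i (fun u => (all p u)%:R).
pose b B i := cmean i (fun u => (all (predC p) u)%:R * B u).
have aE i : i%:R * a i = \sum_(1 <= c < i.+1 | p c) a (i - c)%N.
  case: (posnP i) => [->|i0]; first by rewrite mul0r big_geq.
  rewrite cmean_step // [RHS]big_mkcond; apply: eq_bigr => c _.
  rewrite /a; case: ifP => pc; first by apply: eq_cmean => u /=; rewrite pc.
  by rewrite -[RHS](cmean_const0 (i - c)); apply: eq_cmean => u /=; rewrite pc.
have bE i : i%:R * b B i =
    \sum_(1 <= c < i.+1 | ~~ p c) b (fun u => B (c :: u)) (i - c)%N.
  case: (posnP i) => [->|i0]; first by rewrite mul0r big_geq.
  rewrite cmean_step // [RHS]big_mkcond; apply: eq_bigr => c _.
  rewrite /b; case: ifP => pc; first by apply: eq_cmean => u /=; rewrite pc.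
  rewrite -[RHS](cmean_const0 (i - c)); apply: eq_cmean => u /=.
  by rewrite pc mul0r.
apply: (mulfI nz); rewrite cmean_step // mulr_sumr.
under [RHS]eq_bigr => i _ do rewrite -/(a i) -/(b B (n - i)%N).
rewrite -(big_mkord xpredT (fun i => n%:R * (a i * b B (n - i)%N))).
(* The factor n is written as i + (n - i), and each summand is absorbed by the recursion of its own
   factor: [F] collects removed lengths in p, [G] those outside. Summing over i first then gives the
   induction hypothesis at n - c. *)
pose F c i := if p c then a (i - c)%N * b B (n - i)%N else 0.
pose G c i := if ~~ p c then a i * b (fun u => B (c :: u)) (n - i - c)%N else 0.
transitivity (\sum_(0 <= i < n.+1)
  (\sum_(1 <= c < n.+1 | (c <= i)%N) F c i
   + \sum_(1 <= c < n.+1 | (c <= n - i)%N) G c i)); last first.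
  apply: eq_big_nat => i /andP[_ ilt].
  rewrite -[n in n%:R](subnKC (_ : i <= n)%N) // natrD mulrDl mulrA aE.
  rewrite [X in _ = _ + X]mulrCA bE mulr_suml mulr_sumr.
  congr (_ + _).
    rewrite [RHS](big_nat_widen _ _ n.+1) //=.
    rewrite -big_mkcondr /=; apply: eq_bigl => c.
    by rewrite ltnS andbC.
  rewrite [RHS](big_nat_widen _ _ n.+1) /=; last lia.
  rewrite -big_mkcondr /=; apply: eq_bigl => c.
  by rewrite ltnS andbC.
rewrite big_split /= (exchange_big_dep_nat xpredT) //=.
rewrite [X in _ + X](exchange_big_dep_nat xpredT) //= -big_split /=.
apply: eq_big_nat => c /andP[c1 cn].
case pc: (p c).
  rewrite [X in _ = _ + X]big1; last by move=> i _; rewrite /G pc.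
  rewrite addr0 /F pc (big_cat_nat (n := c)) //=; last lia.
  rewrite [X in _ = X + _]big1_seq ?add0r; last first.
    by move=> i; rewrite mem_index_iota; lia.
  rewrite -[c in \sum_(c <= _ < _ | _) _]add0n.
  rewrite (big_addn 0 n.+1 c) big_mkcond /=.
  rewrite IHn; last lia.
  rewrite -(big_mkord xpredT (fun i => a i * b B (n - c - i)%N)).
  rewrite (_ : (n.+1 - c = (n - c).+1)%N); last lia.
  apply: eq_big_nat => i ilt; rewrite leq_addl addnK.
  by congr (_ * b _ _); lia.
rewrite [X in _ = X + _]big1; last by move=> i _; rewrite /F pc.
rewrite add0r /G pc /=.
rewrite (IHn _ _ (fun u => B (c :: u))); last lia.
rewrite -(big_mkord xpredT (fun i => a i * b (fun u => B (c :: u)) (n - c - i)%N)).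
rewrite [RHS](big_cat_nat (n := (n - c).+1)) //=; last lia.
rewrite [X in _ = _ + X]big1_seq ?addr0; last first.
  by move=> i; rewrite mem_index_iota; lia.
rewrite [RHS]big_mkcond /=; apply: eq_big_nat => i ilt.
have -> : (c <= n - i)%N by lia.
by rewrite subnAC.
Qed.

(** * Permutations without cycle lengths divisible by q *)

Definition reg (q n : nat) : rat :=
  cmean n (fun u => (all (predC (dvdn q)) u)%:R).

Lemma reg0 q : reg q 0 = 1.
Proof. by rewrite /reg cmean0. Qed.

Lemma reg_ge0 q n : 0 <= reg q n.
Proof. by apply: cmean_ge0 => u; rewrite ler0n. Qed.

(** The sum runs over the number m = n - c of points left, so that q not dividing c reads as a
    congruence condition. *)
Lemma reg_rec q n :
  n%:R * reg q n = \sum_(m < n | (m != n %[mod q])%N) reg q m.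
Proof.
case: (posnP n) => [->|n0]; first by rewrite mul0r big_ord0.
rewrite -(big_mkord (fun m => (m != n %[mod q])%N) (reg q)) big_nat_rev.
rewrite cmean_step // big_add1 /= [RHS]big_mkcond /=.
apply: eq_big_nat => c /andP[_ cn]; rewrite add0n.
rewrite eq_sym eqn_mod_dvd; last lia.
rewrite (_ : n - (n - c.+1) = c.+1)%N; last lia.
by case: ifP => qc //; rewrite cmean_const0.
Qed.

(* The difference of the recursions [reg_rec] at n+1 and n is a sum over
   m <> n mod q of the increments of [reg], which vanish unless q | m+1. *)
Lemma reg_step q n :
  n.+1%:R * reg q n.+1 = (n.+1 - (q %| n.+1))%:R * reg q n.
Proof.
elim/ltn_ind: n => n IHn.
have step m : (m < n)%N -> ~~ (q %| m.+1)%N -> reg q m.+1 - reg q m = 0.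
  move=> mn qm; have := IHn m mn; rewrite (negbTE qm) subn0.
  by move/mulfI => ->; rewrite ?subrr // pnatr_eq0.
have diff : n.+1%:R * reg q n.+1 - n%:R * reg q n = (~~ (q %| n.+1)%N)%:R +
    \sum_(m < n | (m != n %[mod q])%N) (reg q m.+1 - reg q m).
  rewrite !reg_rec [\sum_(m < n.+1 | _) _]big_mkcond big_ord_recl /= -/(dvdn q n.+1).
  rewrite mod0n eq_sym -/(dvdn q n.+1).
  under eq_bigr => m _ do rewrite /bump /= eqn_modDl.
  rewrite -big_mkcond sumrB /= addrA; congr (_ + _ - _).
  by case: (q %| n.+1)%N.
case qn: (q %| n.+1)%N diff => /=.
  (* If q divides n+1, then m <> n mod q means that q does not divide m+1, so all increments
     vanish. *)
  rewrite add0r big1 => [|m mn]; last first.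
    apply: step => //; apply: contraNN mn => qm.
    rewrite -(eqn_modDl 1) /= !add1n; move: qm qn.
    by rewrite /dvdn => /eqP-> /eqP->.
  by move/eqP; rewrite subr_eq0 => /eqP->; rewrite subn1.
move=> diff; rewrite subn0; apply/eqP; rewrite -subr_eq0; apply/eqP.
(* If q does not divide n+1, the omitted indices m = n mod q have zero increment; restoring them
   makes the sum telescope. *)
have tele : \sum_(m < n | (m != n %[mod q])%N) (reg q m.+1 - reg q m)
    = reg q n - 1.
  rewrite -(reg0 q) -telescope_sumr // big_mkord.
  rewrite big_mkcond; apply: eq_bigr => m _; case: ifPn => //.
  rewrite negbK -(eqn_modDl 1) !add1n => /eqP mn; rewrite step //.
  by move: qn; rewrite /dvdn mn => ->.
by move: diff; rewrite tele -natr1 => diff; lra.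
Qed.

Lemma reg_eq q n : ~~ (q %| n.+1)%N -> reg q n.+1 = reg q n.
Proof.
move=> qn; have := reg_step q n; rewrite (negbTE qn) subn0.
by move/mulfI => -> //; rewrite pnatr_eq0.
Qed.

Lemma reg_le q n : reg q n.+1 <= reg q n.
Proof.
have n0 : 0 < n.+1%:R :> rat by rewrite ltr0n.
rewrite -(ler_pM2l n0) reg_step ler_wpM2r ?reg_ge0 // ler_nat leq_subr.
by [].
Qed.

Lemma reg_block q n i : (i < q)%N -> (q %| n)%N -> reg q (n + i) = reg q n.
Proof.
move=> + qn; elim: i => [|i IHi] iq; first by rewrite addn0.
rewrite addnS reg_eq ?IHi ?(ltnW iq) // -addnS dvdn_addr //.
by rewrite gtnNdvd.
Qed.

Lemma reg_mul q k : (0 < q)%N ->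
  (q * k.+1)%:R * reg q (q * k.+1) = (q * k.+1 - 1)%:R * reg q (q * k).
Proof.
case: q => // q _.
have E : (q.+1 * k.+1 = (q.+1 * k + q).+1)%N by lia.
rewrite E reg_step -E dvdn_mulr // reg_block ?dvdn_mulr //.
Qed.

Lemma reg_pred q M : (0 < q)%N -> (0 < M)%N ->
  reg q (q * M).-1 = reg q (q * M.-1).
Proof.
case: q => // q _; case: M => // M _.
have -> : ((q.+1 * M.+1).-1 = q.+1 * M + q)%N by lia.
by rewrite reg_block ?dvdn_mulr.
Qed.

(* By [reg_mul], this is (1 - 1/(qt))^2 >= 1 - 1/t for q >= 2 and t = k + 1. *)
Lemma reg_sqr_mono q k : (1 < q)%N ->
  k%:R * reg q (q * k) ^+ 2 <= k.+1%:R * reg q (q * k.+1) ^+ 2.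
Proof.
move=> q1; have q0 : (0 < q)%N by lia.
have K0 : 0 < (q * k.+1)%:R :> rat by rewrite ltr0n muln_gt0 q0.
rewrite -(ler_pM2l (exprn_gt0 2 K0)) [leRHS]mulrCA -exprMn reg_mul // exprMn.
rewrite [leLHS]mulrA [leRHS]mulrA ler_wpM2r ?exprn_ge0 ?reg_ge0 //.
rewrite -!natrX -!natrM ler_nat; nia.
Qed.

(** A lower bound on [reg] of order k^(-1/2), kept in squared form to stay within the rationals. *)
Lemma reg_sqr_lb q k j : (1 < q)%N -> (j <= k)%N ->
  j%:R * reg q (q * j) ^+ 2 <= k%:R * reg q (q * k) ^+ 2.
Proof.
move=> q1 /subnKC <-; elim: (k - j)%N => [|i IHi]; first by rewrite addn0.
by rewrite addnS; apply: le_trans IHi (reg_sqr_mono _ _).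
Qed.

Lemma reg_q_ge q : (1 < q)%N -> 1 / 2%:R <= reg q q.
Proof.
move=> q1; have := @reg_mul q 0 (ltnW q1); rewrite muln1 muln0 reg0 mulr1 => E.
have q0 : 0 < q%:R :> rat by rewrite ltr0n; lia.
rewrite -(ler_pM2l q0) E natrB; last lia.
have : (2%:R : rat) <= q%:R by rewrite ler_nat.
lra.
Qed.

(** * Permutations with all cycle lengths divisible by q *)

(** Quantifying over the lengths that occur is enough: any other has count 0, which r divides. *)
Definition rooted (q r : nat) (u : seq nat) : bool :=
  all (fun c => (q %| c) ==> (r %| count_mem c u))%N u.

Definition sing_rooted (q r : nat) (u : seq nat) : bool :=
  all (fun c => (q %| c) && (r %| count_mem c u))%N u.

Definition sing (q r n : nat) : rat := cmean n (fun u => (sing_rooted q r u)%:R).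

Lemma sing0 q r : sing q r 0 = 1.
Proof. by rewrite /sing cmean0. Qed.

Lemma sing_ge0 q r n : 0 <= sing q r n.
Proof. by apply: cmean_ge0 => u; rewrite ler0n. Qed.

Lemma rooted_perm q r u v : perm_eq u v -> rooted q r u = rooted q r v.
Proof.
move=> uv; rewrite /rooted (perm_all _ uv); apply: eq_all => c.
by rewrite (seq.permP uv).
Qed.

Lemma sing_rooted_perm q r u v :
  perm_eq u v -> sing_rooted q r u = sing_rooted q r v.
Proof.
move=> uv; rewrite /sing_rooted (perm_all _ uv); apply: eq_all => c.
by rewrite (seq.permP uv).
Qed.

(** Lengths not divisible by q are unconstrained and do not affect the other counts, so [rooted]
    depends only on the part of the list seen by the second factor of [cmean_split]. *)
Lemma rooted_filter q r u : rooted q r (filter (dvdn q) u) = rooted q r u.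
Proof.
rewrite /rooted all_filter; apply: eq_all => c /=.
case qc: (q %| c)%N => //=; congr (_ %| _)%N.
rewrite count_filter; apply: eq_count => x /=.
by case: eqP => // ->; rewrite qc.
Qed.

Lemma cmean_rooted q r n :
  cmean n (fun u => (rooted q r u)%:R) =
  \sum_(i < n.+1) reg q i * sing q r (n - i).
Proof.
rewrite -(eq_cmean n (P := fun u =>
  (rooted q r (filter (predC (predC (dvdn q))) u))%:R)); last first.
  move=> u; rewrite -[rooted q r u]rooted_filter; congr (rooted _ _ _)%:R.
  by apply: eq_filter => c /=; rewrite negbK.
rewrite (cmean_split n (predC (dvdn q)) (fun u => (rooted q r u)%:R)).
apply: eq_bigr => i _; congr (_ * _); apply: eq_cmean => u.
rewrite -natrM mulnb /rooted /sing_rooted -all_predI; congr (nat_of_bool _)%:R.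
by apply: eq_all => c /=; rewrite negbK; case: (q %| c)%N.
Qed.

(** Every count changes by 0 or by r. *)
Lemma sing_rooted_nseq q r c u :
  (q %| c)%N -> sing_rooted q r (nseq r c ++ u) = sing_rooted q r u.
Proof.
move=> qc; rewrite /sing_rooted all_cat.
rewrite [X in _ && X](eq_all (a2 := fun d => (q %| d) && (r %| count_mem d u))%N).
  rewrite andb_idl // => /allP H; rewrite all_nseq qc /= count_cat count_nseq.
  rewrite /= eqxx mul1n dvdn_addr //.
  case: (boolP (c \in u)) => [/H/andP[_ ->]|/count_memPn ->]; first by rewrite orbT.
  by rewrite dvdn0 orbT.
move=> d; rewrite /= count_cat count_nseq dvdn_addr //.
exact: dvdn_mull.
Qed.

(* Markov's inequality for the number of c-cycles, applied k times: once r - k of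
   them have been removed, at least k remain. *)
Lemma cmean_sing_nseq q r c k n :
  (0 < c)%N -> (q %| c)%N -> (k < r)%N ->
  (c ^ k * k`!)%:R *
    cmean n (fun u => (sing_rooted q r (nseq (r - k) c ++ u))%:R)
  <= if (k * c <= n)%N then sing q r (n - k * c) else 0.
Proof.
move=> c0 qc; elim: k n => [|k IHk] n kr.
  rewrite mul1r mul0n /= !subn0; under eq_cmean => u do rewrite sing_rooted_nseq //.
  by [].
pose Bk i u : rat := (sing_rooted q r (nseq (r - i) c ++ u))%:R.
have BkP i : perm_eq_fun (Bk i).
  move=> u v uv; rewrite /Bk.
  by rewrite (@sing_rooted_perm _ _ _ (nseq (r - i) c ++ v)) ?perm_cat2l.
have markov : k.+1%:R * cmean n (Bk k.+1)
    <= cmean n (fun u => Bk k.+1 u * (count_mem c u)%:R).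
  rewrite -cmeanZ; apply: ler_cmean => u.
  rewrite /Bk; case: (boolP (sing_rooted _ _ _)) => [/allP H|_]; last first.
    by rewrite mulr0 mul0r.
  (* The count of c in the whole list is a multiple of r, and it is positive because r - (k+1) > 0;
     hence it is at least r, and u contains at least k+1 copies. *)
  have /H : c \in nseq (r - k.+1) c ++ u by rewrite mem_cat mem_nseq eqxx; lia.
  move=> /andP[_]; rewrite count_cat count_nseq /= eqxx mul1n => /dvdn_leq.
  by rewrite mulr1 mul1r ler_nat; lia.
have -> : (c ^ k.+1 * k.+1`!)%:R = (c ^ k * k`!)%:R * (c%:R * k.+1%:R) :> rat.
  by rewrite expnS factS !natrM; ring.
rewrite -!mulrA.
apply: (@le_trans _ _ ((c ^ k * k`!)%:R *
   (if (c <= n)%N then cmean (n - c) (Bk k) else 0))).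
  rewrite ler_wpM2l ?ler0n //.
  have -> : (if (c <= n)%N then cmean (n - c) (Bk k) else 0) =
    c%:R * cmean n (fun u => Bk k.+1 u * (count_mem c u)%:R).
    rewrite cmean_count //; case: ifP => // _; apply: eq_cmean => u.
    rewrite /Bk (_ : r - k = (r - k.+1).+1)%N; last lia.
    congr (nat_of_bool _)%:R; apply: sing_rooted_perm.
    by rewrite /= -cat_cons -cat1s perm_sym -[c :: u]cat1s perm_catCA.
  by rewrite ler_wpM2l ?ler0n.
case: (leqP c n) => cn; last by rewrite mulr0 ifN // -ltnNge mulSn; lia.
apply: le_trans (IHk _ (ltnW kr)) _.
by rewrite mulSn -leq_subRL // subnDA.
Qed.

(** If the first cycle drawn has length c, [cmean_sing_nseq] with k = r - 1 removes r - 1 further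
    c-cycles. *)
Lemma sing_rec q r n : (1 < r)%N ->
  n%:R * sing q r n <= \sum_(1 <= c < n.+1 | (q %| c)%N && (r * c <= n)%N)
    sing q r (n - r * c) / (c ^ r.-1 * r.-1`!)%:R.
Proof.
move=> r1; case: (posnP n) => [->|n0].
  by rewrite mul0r big1_seq // => i; rewrite mem_index_iota; lia.
rewrite cmean_step // [leRHS]big_mkcond /= !big_nat; apply: ler_sum => c /andP[c1 cn].
case qc: (q %| c)%N => /=; last first.
  by under eq_cmean => u do rewrite /sing_rooted /= qc; rewrite cmean_const0.
have := @cmean_sing_nseq q r c r.-1 (n - c) c1 qc.
rewrite (_ : r - r.-1 = 1)%N; last lia.
have D : 0 < (c ^ r.-1 * r.-1`!)%:R :> rat.
  by rewrite ltr0n muln_gt0 expn_gt0 c1 fact_gt0.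
rewrite (_ : (r.-1 * c <= n - c) = (r * c <= n))%N; last nia.
move=> /(_ _)/le_trans H; case: ifP H => rc H.
  rewrite ler_pdivlMr // mulrC; apply: H; first lia.
  by rewrite (_ : n - c - r.-1 * c = n - r * c)%N //; nia.
by rewrite -(pmulr_rle0 _ D); apply: H => //; lia.
Qed.

(** Each step of [sing_rec] removes r c points with q dividing c, hence a multiple of q r. *)
Lemma sing_eq0 q r n : (1 < r)%N -> ~~ (q * r %| n)%N -> sing q r n = 0.
Proof.
move=> r1; elim/ltn_ind: n => n IHn qn.
have n0 : (0 < n)%N by case: n qn {IHn} => //; rewrite dvdn0.
apply/eqP; rewrite eq_le sing_ge0 andbT.
rewrite -(pmulr_rle0 (sing q r n) (_ : 0 < n%:R)) ?ltr0n //.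
apply: le_trans (sing_rec q n r1) _; rewrite big1_seq // => c.
rewrite mem_index_iota => /andP[/andP[qc rc] /andP[c1 cn]].
rewrite IHn ?mul0r //; first nia.
apply: contraNN qn => H; rewrite -(subnK rc) dvdn_addl // mulnC.
exact: dvdn_mul.
Qed.

(** * Quadratic decay of [sing] *)

Lemma sum_multiples (F : nat -> rat) q K : (0 < q)%N ->
  \sum_(0 <= c < q * K | (q %| c)%N) F c = \sum_(0 <= i < K) F (q * i)%N.
Proof.
move=> q0; elim: K => [|K IHK]; first by rewrite muln0 !big_geq.
rewrite big_nat_recr //= -IHK (big_cat_nat (n := (q * K)%N)) //=; last first.
  by rewrite leq_mul2l leqnSn orbT.
congr (_ + _); rewrite big_ltn_cond; last (rewrite ltn_mul2l q0; exact: ltnSn).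
rewrite dvdn_mulr // big1_seq ?addr0 // => c.
rewrite mem_index_iota => /andP[/dvdnP[d ->]] /andP[l1 l2]; exfalso.
have : (K < d)%N by rewrite -(ltn_pmul2r q0) mulnC.
by apply/negP; rewrite -leqNgt -ltnS -(ltn_pmul2r q0) [X in (_ < X)%N]mulnC.
Qed.

(** The right side of [sing_rec] with c = q i, freed of the factor q^(r-1) (r-1)! in the
    denominators and with i^(r-1) lowered to i, which gives one bound for all r. *)
Definition sing_conv (q r M : nat) : rat :=
  \sum_(1 <= i < M.+1) sing q r (q * r * (M - i)) / i%:R.

Lemma sing_mul_rec q r M : (0 < q)%N -> (1 < r)%N -> (0 < M)%N ->
  (q * r * M)%:R * sing q r (q * r * M)
    <= sing_conv q r M / (q ^ r.-1 * r.-1`!)%:R.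
Proof.
move=> q0 r1 M0.
pose F c := sing q r (q * r * M - r * c) / (c ^ r.-1 * r.-1`!)%:R.
apply: (@le_trans _ _ (\sum_(1 <= c < (q * r * M).+1
  | (q %| c)%N && (r * c <= q * r * M)%N) F c)); first exact: sing_rec.
have D : 0 < (q ^ r.-1 * r.-1`!)%:R :> rat.
  by rewrite ltr0n muln_gt0 expn_gt0 q0 fact_gt0.
apply: (@le_trans _ _ (\sum_(1 <= i < M.+1) F (q * i)%N)); last first.
  rewrite /sing_conv mulr_suml !big_nat; apply: ler_sum => i /andP[i1 iM].
  rewrite /F -mulrA (_ : q * r * M - r * (q * i) = q * r * (M - i))%N; last nia.
  rewrite ler_wpM2l ?sing_ge0 // -invfM lef_pV2 ?posrE ?mulr_gt0 ?ltr0n //;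
    try by rewrite muln_gt0 expn_gt0 ?muln_gt0 q0 ?i1 fact_gt0.
  rewrite -natrM ler_nat expnMn -[leqRHS]mulnA mulnCA leq_mul2l leq_mul2r.
  by rewrite -{1}[i]expn1 leq_pexp2l ?orbT //; lia.
(* [sum_multiples] starts at 0, so the term at 0 is set to 0. *)
pose G c := if (0 < c)%N then F c else 0.
have -> : \sum_(1 <= i < M.+1) F (q * i)%N = \sum_(0 <= i < M.+1) G (q * i)%N.
  rewrite [RHS]big_ltn // /G muln0 /= add0r; apply: eq_big_nat => i /andP[i1 _].
  by rewrite muln_gt0 q0 i1.
rewrite -sum_multiples // [X in _ <= X]big_ltn_cond; last by rewrite muln_gt0 q0.
rewrite dvdn0 {1}/G /= add0r.
rewrite [X in X <= _](big_cat_nat (n := (q * M.+1)%N)) /=; [|nia|nia].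
rewrite [X in _ + X <= _]big1_seq ?addr0; last first.
  move=> c; rewrite mem_index_iota => /andP[/andP[/dvdnP[d ->] H] /andP[l1 l2]].
  exfalso; have : (M < d)%N by nia.
  nia.
rewrite big_mkcond [X in _ <= X]big_mkcond /= !big_nat.
apply: ler_sum => c /andP[c0 _]; rewrite /G c0.
case qc: (q %| c)%N => //=; case: ifP => //= _.
by rewrite /F mulr_ge0 ?sing_ge0 // invr_ge0 ler0n.
Qed.

(** For j >= 2, 1/j^2 <= 1/(j-1) - 1/j, and the sum telescopes. *)
Lemma sum_invsqr_le k : \sum_(1 <= j < k.+2) (j%:R ^+ 2)^-1 <= 2%:R - k.+1%:R^-1 :> rat.
Proof.
elim: k => [|k IHk]; first by rewrite big_nat1.
rewrite big_nat_recr //=; apply: le_trans (lerD IHk (lexx _)) _.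
rewrite -addrA lerD2l.
have k0 : 0 < k.+1%:R :> rat by rewrite ltr0n.
rewrite -[k.+2%:R]natr1; move: k.+1%:R k0 => x k0.
rewrite -subr_ge0.
have -> : - (x + 1)^-1 - (- x^-1 + ((x + 1) ^+ 2)^-1) = (x * (x + 1) ^+ 2)^-1.
  by field; rewrite !gt_eqF // addr_gt0.
by apply: ltW; rewrite invr_gt0 mulr_gt0 // exprn_gt0 // addr_gt0.
Qed.

(* M / (i j^2) = 1 / j^2 + 1 / (i j) for i + j = M. *)
Lemma sum_conv_le M : (0 < M)%N ->
  \sum_(1 <= i < M) (i%:R * (M - i)%:R ^+ 2)^-1 <= 3%:R / M%:R :> rat.
Proof.
case: M => [//|[_|M _]]; first by rewrite big_geq // divr_ge0 ?ler0n.
have M0 : 0 < M.+2%:R :> rat by rewrite ltr0n.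
rewrite ler_pdivlMr // mulr_suml.
apply: (@le_trans _ _ (\sum_(1 <= i < M.+2) (((M.+2 - i)%:R ^+ 2)^-1 + M.+1%:R^-1))).
  rewrite !big_nat; apply: ler_sum => i /andP[i1 iM].
  have i0 : 0 < i%:R :> rat by rewrite ltr0n.
  have j0 : 0 < (M.+2 - i)%:R :> rat by rewrite ltr0n; lia.
  have -> : M.+2%:R = i%:R + (M.+2 - i)%:R :> rat by rewrite -natrD subnKC //; lia.
  have xy : M.+1%:R <= i%:R * (M.+2 - i)%:R :> rat by rewrite -natrM ler_nat; nia.
  move: i%:R (M.+2 - i)%:R i0 j0 xy => x y x0 y0 xy.
  have -> : (x * y ^+ 2)^-1 * (x + y) = (y ^+ 2)^-1 + (x * y)^-1.
    by field; rewrite !gt_eqF.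
  by rewrite lerD2l lef_pV2 ?posrE ?mulr_gt0 ?ltr0n.
rewrite big_split /= big_nat_rev /=.
have -> : \sum_(1 <= i < M.+2) ((M.+2 - (1 + M.+2 - i.+1))%:R ^+ 2)^-1 =
   \sum_(1 <= i < M.+2) (i%:R ^+ 2)^-1 :> rat.
  apply: eq_big_nat => i iM.
  by rewrite (_ : M.+2 - (1 + M.+2 - i.+1) = i)%N //; lia.
(* The M+1 cross terms contribute 1 in all and the inverse squares at most 2, whence the constant
   3. *)
rewrite sumr_const_nat subn1 /= -[_ *+ _]mulr_natl divff ?pnatr_eq0 //.
have := sum_invsqr_le M; have : 0 <= M.+1%:R^-1 :> rat by rewrite invr_ge0 ler0n.
move: M.+1%:R^-1 => y y0 S; rewrite -lerBrDr; apply: le_trans S _; lra.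
Qed.

(** The term i = M contributes 1/M, and the others at most 3/(5M) by [sum_conv_le]. The bound on
    [sing] is a hypothesis here so that the lemma can serve inside the induction that proves it. *)
Lemma sing_conv_le_aux q r M : (0 < M)%N ->
  (forall i, (0 < i < M)%N -> sing q r (q * r * i) <= (5%:R * i%:R ^+ 2)^-1) ->
  sing_conv q r M <= 8%:R / 5%:R / M%:R.
Proof.
move=> M0 H; rewrite /sing_conv big_nat_recr //= subnn muln0 sing0 div1r.
apply: (@le_trans _ _ (5%:R^-1 * (3%:R / M%:R) + M%:R^-1)); last first.
  by rewrite le_eqVlt; apply/orP; left; apply/eqP; field; rewrite pnatr_eq0 -lt0n.
rewrite lerD2r; 
apply: (@le_trans _ _ (5%:R^-1 *
  \sum_(1 <= i < M) (i%:R * (M - i)%:R ^+ 2)^-1)); last first.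
  by rewrite ler_wpM2l ?invr_ge0 ?ler0n // sum_conv_le.
rewrite mulr_sumr !big_nat; apply: ler_sum => i /andP[i1 iM].
have i0 : 0 < i%:R :> rat by rewrite ltr0n.
rewrite ler_pdivrMr //; apply: le_trans (H _ _) _; first lia.
have : 0 < (M - i)%:R :> rat by rewrite ltr0n; lia.
move: i%:R (M - i)%:R i0 => x y x0 y0.
rewrite le_eqVlt; apply/orP; left; apply/eqP; field.
by rewrite !gt_eqF.
Qed.

(** Since q r >= 4 and q^(r-1) (r-1)! >= 2, a bound C/M^2 reproduces itself as soon as (1 + 3C)/8 <=
    C; C = 1/5 is the case of equality. *)
Lemma sing_le q r M : (1 < q)%N -> (1 < r)%N -> (0 < M)%N ->
  sing q r (q * r * M) <= (5%:R * M%:R ^+ 2)^-1.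
Proof.
move=> q1 r1; elim/ltn_ind: M => M IHM M0.
have Mp : 0 < M%:R :> rat by rewrite ltr0n.
have C : sing_conv q r M <= 8%:R / 5%:R / M%:R.
  by apply: sing_conv_le_aux => // i /andP[i0 iM]; apply: IHM.
have := sing_mul_rec (ltnW q1) r1 M0.
have A2 : 2%:R <= (q ^ r.-1 * r.-1`!)%:R :> rat.
  rewrite ler_nat; apply: (@leq_trans (q ^ 1 * 1)); first lia.
  by rewrite leq_mul ?fact_gt0 // leq_pexp2l; lia.
have A0 : 0 < (q ^ r.-1 * r.-1`!)%:R :> rat by apply: lt_le_trans A2.
rewrite ler_pdivlMr //.
have B4 : 4%:R <= (q * r)%:R :> rat by rewrite ler_nat; nia.
rewrite natrM => H.
have S0 := sing_ge0 q r (q * r * M).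
move: H S0 C; set s := sing _ _ _ => H S0 C.
rewrite -[X in _ <= X]div1r ler_pdivlMr; last by rewrite mulr_gt0 ?exprn_gt0.
have : 8%:R * (M%:R * s) <= 8%:R / 5%:R / M%:R.
  apply: le_trans C; apply: le_trans H.
  have Ms : 0 <= M%:R * s by rewrite mulr_ge0 // ltW.
  set a : rat := (q ^ _ * _)%:R in A2 *; set b : rat := (q * r)%:R in B4 *.
  rewrite (_ : b * M%:R * s * a = (a * b) * (M%:R * s)); last ring.
  by rewrite ler_wpM2r //; nra.
rewrite ler_pdivlMr // => H2.
rewrite expr2; lra.
Qed.

Lemma sing_conv_le q r M : (1 < q)%N -> (1 < r)%N -> (0 < M)%N ->
  sing_conv q r M <= 8%:R / 5%:R / M%:R.
Proof.
by move=> q1 r1 M0; apply: sing_conv_le_aux => // i /andP[i0 _]; apply: sing_le.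
Qed.

(** * Comparison of [sing] with [reg] *)

(** These are the numbers binomial(2k, k) / 4^k for k = 1, 3, 5. *)
Lemma reg2_small : [/\ reg 2 2 = 1 / 2%:R, reg 2 6 = 5%:R / 16%:R
  & reg 2 10 = 63%:R / 256%:R].
Proof.
have E k : reg 2 (2 * k.+1) = (2 * k.+1 - 1)%:R / (2 * k.+1)%:R * reg 2 (2 * k).
  have k0 : (2 * k.+1)%:R != 0 :> rat by rewrite pnatr_eq0.
  by apply: (mulfI k0); rewrite reg_mul // mulrA mulrCA divff // mulr1.
have E1 : reg 2 2 = 1 / 2%:R by rewrite (E 0%N) mulr1.
have E2 : reg 2 4 = 3%:R / 4%:R * reg 2 2 by exact: (E 1%N).
have E3 : reg 2 6 = 5%:R / 6%:R * reg 2 4 by exact: (E 2).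
have E4 : reg 2 8 = 7%:R / 8%:R * reg 2 6 by exact: (E 3).
have E5 : reg 2 10 = 9%:R / 10%:R * reg 2 8 by exact: (E 4).
by rewrite E5 E4 E3 E2 E1; split=> //; field.
Qed.

(** For q = r = 2, with x = M; the hypothesis is [reg_sqr_lb] started at j = 3. If x y < 4/5, then
    75/256 x^2 <= 16/25 (2x - 1), which fails for x >= 4 but not at x = 3. *)
Lemma le_of_sqr_ge22 (R : realFieldType) (x y : R) :
  4%:R <= x -> 0 <= y ->
  3%:R * (5%:R / 16%:R) ^+ 2 <= (2%:R * x - 1) * y ^+ 2 -> 4%:R / 5%:R / x <= y.
Proof.
move=> x4 y0 S; have x0 : 0 < x by lra.
rewrite ler_pdivrMr // leNgt; apply/negP => u.
have u2 : (y * x) ^+ 2 <= 16%:R / 25%:R.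
  have : 0 <= y * x by nra.
  by move: (y * x) u => w w1 w0; nra.
have S2 : 75%:R / 256%:R * x ^+ 2 <= (2%:R * x - 1) * (y * x) ^+ 2.
  have := ler_wpM2r (exprn_ge0 2 (ltW x0)) S.
  rewrite -[X in _ <= X]mulrA -exprMn; lra.
have : (2%:R * x - 1) * (y * x) ^+ 2 <= (2%:R * x - 1) * (16%:R / 25%:R).
  by rewrite ler_wpM2l //; lra.
by move=> /(le_trans S2); clear -x4; nra.
Qed.

(** For r >= 3, with x = r and m = M. Put w = (x-1) m, so that x m <= 3/2 w; then y w < 2/5 would
    give w^2/4 <= 4/25 (3/2 w - 1), which is impossible. *)
Lemma le_of_sqr_ge (R : realFieldType) (x m y : R) :
  3%:R <= x -> 1 <= m -> 0 <= y -> 1 / 4%:R <= (x * m - 1) * y ^+ 2 ->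
  2%:R / (5%:R * (x - 1) * m) <= y.
Proof.
move=> x3 m1 y0 S; have xm : 3%:R <= x * m by nra.
have x1 : 0 < x * m - 1 by lra.
have w2 : 2%:R <= (x - 1) * m by nra.
have E : x * m <= 3%:R / 2%:R * ((x - 1) * m) by nra.
rewrite -mulrA; move: ((x - 1) * m) (x * m) E w2 x1 S => w z E w2 x1 S {xm}.
rewrite ler_pdivrMr ?mulr_gt0 //; last lra.
rewrite leNgt; apply/negP => u.
have u2 : (y * w) ^+ 2 <= 4%:R / 25%:R.
  have : 0 <= y * w by nra.
  by rewrite mulrCA in u; move: (y * w) u => v; clear=> *; nra.
have S2 : 1 / 4%:R * w ^+ 2 <= (z - 1) * (y * w) ^+ 2.
  have w0 : 0 <= w by lra.
  have := ler_wpM2r (exprn_ge0 2 w0) S.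
  by rewrite -[X in _ <= X]mulrA -exprMn.
have : (z - 1) * (y * w) ^+ 2 <= (z - 1) * (4%:R / 25%:R).
  by rewrite ler_wpM2l // ltW.
by move=> /(le_trans S2); clear -w2 E; nra.
Qed.

Lemma sing_conv1 q r : sing_conv q r 1 = 1.
Proof. by rewrite /sing_conv big_nat1 subnn muln0 sing0 divr1. Qed.

Lemma sing_conv2 q r : sing_conv q r 2 = sing q r (q * r) + 1 / 2%:R.
Proof.
rewrite /sing_conv big_ltn // big_nat1 subnn muln0 sing0.
by rewrite (_ : 2 - 1 = 1)%N // muln1 divr1.
Qed.

Lemma sing_conv3 q r :
  sing_conv q r 3 = sing q r (q * r * 2) + sing q r (q * r) / 2%:R + 1 / 3%:R.
Proof.
rewrite /sing_conv big_ltn // big_ltn // big_nat1 subnn muln0 sing0.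
by rewrite (_ : 3 - 1 = 2)%N // (_ : 3 - 2 = 1)%N // muln1 divr1 addrA.
Qed.

Lemma sing_mul_le_reg22 M : (0 < M)%N ->
  (4 * M)%:R * sing 2 2 (4 * M) <= reg 2 (2 * (2 * M).-1).
Proof.
move=> M0; have [R1 R3 R5] := reg2_small.
have H k : (0 < k)%N -> (4 * k)%:R * sing 2 2 (4 * k) <= sing_conv 2 2 k / 2%:R.
  by move=> k0; exact: (@sing_mul_rec 2 2 k).
have H1 : 4%:R * sing 2 2 4 <= 1 / 2%:R.
  by have := H 1%N isT; rewrite sing_conv1.
have H2 : 8%:R * sing 2 2 8 <= (sing 2 2 4 + 1 / 2%:R) / 2%:R.
  by have := H 2 isT; rewrite sing_conv2.
have H3 : 12%:R * sing 2 2 12 <=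
    (sing 2 2 8 + sing 2 2 4 / 2%:R + 1 / 3%:R) / 2%:R.
  by have := H 3 isT; rewrite sing_conv3.
have [G1 G2 G3] : [/\ 4%:R * sing 2 2 4 <= reg 2 2,
    8%:R * sing 2 2 8 <= reg 2 6 & 12%:R * sing 2 2 12 <= reg 2 10].
  rewrite R1 R3 R5; move: (sing 2 2 4) (sing 2 2 8) (sing 2 2 12) H1 H2 H3.
  by clear=> x y z *; split; lra.
(* M = 1, 2, 3 come from iterating the recursion; from M = 4 on, the general estimates suffice. *)
case: M M0 => [//|[|[|[|M]]]] _; [exact: G1|exact: G2|exact: G3|].
move: H {H1 H2 H3 G1 G2 G3 R1 R5} R3 => H R3; set m := M.+4.
have m0 : 0 < m%:R :> rat by rewrite ltr0n.
apply: le_trans (H m isT) _.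
have X : sing_conv 2 2 m / 2%:R <= 4%:R / 5%:R / m%:R.
  have := @sing_conv_le 2 2 m isT isT isT.
  by move: (sing_conv _ _ _) m%:R^-1; clear=> s y; lra.
apply: le_trans X _.
have := @reg_sqr_lb 2 (2 * m).-1 3 isT isT; rewrite R3.
rewrite (_ : (2 * m).-1%:R = 2%:R * m%:R - 1 :> rat); last first.
  by apply: (addIr 1); rewrite subrK natr1 prednK // natrM.
have m4 : 4%:R <= m%:R :> rat by rewrite ler_nat.
exact: (@le_of_sqr_ge22 _ m%:R _ m4 (reg_ge0 _ _)).
Qed.

(** For r >= 3 the divisor q^(r-1) (r-1)! is at least 4 (r-1), so the left side is at most 2/(5
    (r-1) M). On the right, [reg_sqr_lb] from j = 1 with [reg q q] >= 1/2 is then enough. *)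
Lemma sing_mul_le_reg q r M : (1 < q)%N -> (2 < r)%N -> (0 < M)%N ->
  (q * r * M)%:R * sing q r (q * r * M) <= reg q (q * (r * M).-1).
Proof.
move=> q1 r2 M0; have r1 : (1 < r)%N by lia.
apply: le_trans (sing_mul_rec (ltnW q1) r1 M0) _.
have m0 : 0 < M%:R :> rat by rewrite ltr0n.
have C := sing_conv_le q1 r1 M0.
have A : 4%:R * (r%:R - 1) <= (q ^ r.-1 * r.-1`!)%:R :> rat.
  rewrite -[1]/(1%:R) -natrB ?(ltnW r1) // -natrM ler_nat subn1.
  rewrite leq_mul //; last exact: fact_geq.
  apply: (@leq_trans (2 ^ r.-1)).
    by rewrite (@leq_pexp2l 2 2) //; lia.
  by rewrite leq_exp2r; lia.
have x3 : 3%:R <= r%:R :> rat by rewrite ler_nat.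
have B0 : 0 < 4%:R * (r%:R - 1) :> rat by lra.
apply: (@le_trans _ _ (2%:R / (5%:R * (r%:R - 1) * M%:R))).
  rewrite ler_pdivrMr; last exact: lt_le_trans A.
  apply: le_trans C _.
  apply: (@le_trans _ _ (2%:R / (5%:R * (r%:R - 1) * M%:R) *
    (4%:R * (r%:R - 1)))); last first.
    rewrite ler_wpM2l // divr_ge0 // ?mulr_ge0 // ?(ltW m0) //; lra.
  rewrite le_eqVlt; apply/orP; left; apply/eqP; field.
  by rewrite gt_eqF //= gt_eqF //; lra.
have := @reg_sqr_lb q (r * M).-1 1 q1; rewrite muln1 mul1r.
have := reg_q_ge q1; have Y0 := reg_ge0 q (q * (r * M).-1).
move=> z2; rewrite (_ : (r * M).-1%:R = r%:R * M%:R - 1 :> rat); last first.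
  by apply: (addIr 1); rewrite subrK natr1 prednK ?natrM // muln_gt0 M0 ltnW.
have rM : (0 < (r * M).-1)%N by nia.
have m1 : 1 <= M%:R :> rat by rewrite ler1n.
move=> /(_ rM) S; apply: (@le_of_sqr_ge _ r%:R M%:R _ x3 m1 (reg_ge0 _ _)).
apply: le_trans S; move: (reg q q) z2; clear=> z z2; nra.
Qed.

Lemma reg_sing_le q r n : (1 < q)%N -> (q %| r)%N -> (0 < r)%N ->
  reg q n.+1 + sing q r n.+1 <= reg q n.
Proof.
move=> q1 qr r0; have r1 : (1 < r)%N by apply: leq_trans q1 (dvdn_leq r0 qr).
case: (boolP (q * r %| n.+1)%N) => [|qrn]; last first.
  by rewrite sing_eq0 // addr0 reg_le.
case/dvdnP => M nE.
have M0 : (0 < M)%N by case: M nE.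
have n0 : 0 < n.+1%:R :> rat by rewrite ltr0n.
have qn : (q %| n.+1)%N by rewrite nE mulnC -mulnA dvdn_mulr.
(* As (n+1) ([reg q n] - [reg q n.+1]) = [reg q n], it remains to bound (n+1) [sing q r n.+1]. The
   index n = q r M - 1 ends the block of q equal values starting at q (r M - 1). *)
rewrite -(ler_pM2l n0) mulrDr reg_step qn -lerBrDl natrB // -natr1.
have -> : reg q n = reg q (q * (r * M).-1).
  rewrite -reg_pred ?muln_gt0 ?r0 //; last exact: ltnW.
  by congr reg; rewrite -[n]/(n.+1.-1) nE mulnC mulnA.
have -> : (n%:R + 1) * reg q (q * (r * M).-1) - (n%:R + 1 - 1%N%:R) *
   reg q (q * (r * M).-1) = reg q (q * (r * M).-1) by ring.
rewrite natr1 nE mulnC.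
case: (ltnP 2 r) => r2; first exact: sing_mul_le_reg.
have rE : r = 2 by lia.
have qE : q = 2 by move: (dvdn_leq r0 qr); lia.
rewrite rE qE; exact: sing_mul_le_reg22.
Qed.

(** The term i+1 of the convolution at n+1 is compared with the term i at n for i < n; the two end
    terms at n+1 together face the last term at n, which is [reg_sing_le]. *)
Lemma cmean_rooted_le q r n : (1 < q)%N -> (q %| r)%N -> (0 < r)%N ->
  cmean n.+1 (fun u => (rooted q r u)%:R) <= cmean n (fun u => (rooted q r u)%:R).
Proof.
move=> q1 qr r0; rewrite !cmean_rooted big_ord_recl /= subn0 reg0 mul1r.
rewrite big_ord_recr [X in _ <= X]big_ord_recr /= !subnn !sing0 !mulr1 addrCA.
rewrite [X in _ + X]addrC; apply: lerD; last exact: reg_sing_le.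
by apply: ler_sum => i _; rewrite ler_wpM2r ?sing_ge0 ?reg_le.
Qed.

(** * Removing a cycle *)

Lemma sum_subsets_card (T : finType) (B : {set T}) (g : nat -> rat) :
  \sum_(D : {set T} | D \subset B) g #|D| =
  \sum_(0 <= k < #|B|.+1) 'C(#|B|, k)%:R * g k.
Proof.
rewrite big_mkord (partition_big (fun D : {set T} => inord #|D| : 'I_#|B|.+1) xpredT) //=.
apply: eq_bigr => k _; rewrite -cards_draws -[in RHS]sum1_card natr_sum mulr_suml.
apply: eq_big => [D|D /andP[DB /eqP <-]]; last first.
  by rewrite mul1r inordK // ltnS subset_leq_card.
rewrite inE; case: (boolP (D \subset B)) => //= DB.
by rewrite -val_eqE /= inordK // ltnS subset_leq_card.
Qed.

Lemma sum_subsets_with (T : finType) (A : {set T}) x (g : nat -> rat) : x \in A ->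
  \sum_(C : {set T} | (x \in C) && (C \subset A)) g #|C| =
  \sum_(1 <= c < #|A|.+1) 'C(#|A|.-1, c.-1)%:R * g c.
Proof.
move=> xA; have cA : #|A| = #|A :\ x|.+1 by rewrite (cardsD1 x) xA.
rewrite cA big_add1 /= -(sum_subsets_card _ (fun k => g k.+1)).
rewrite (reindex_onto (fun D => x |: D) (fun C => C :\ x)) /=; last first.
  by move=> C /andP[xC _]; rewrite setD1K.
apply: eq_big => [D|D /andP[_ /eqP DE]].
  rewrite setU11 /= subUset sub1set xA /= subsetD1.
  case: (boolP (x \in D)) => xD.
    rewrite andbF; apply/negP => /andP[_ /eqP DE].
    by move: xD; rewrite -DE !inE eqxx.
  by rewrite setU1K // eqxx.
by rewrite cardsU1 -DE !inE eqxx.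
Qed.

(** Smaller point sets are subsets [A] of a fixed type, so a permutation supported on [A] also fixes
    all points outside; these are discarded by keeping only orbits inside [A]. *)
Definition cycle_sizes (T : finType) (A : {set T}) (s : {perm T}) : seq nat :=
  map (fun C : {set T} => #|C|) (enum [set C in porbits s | C \subset A]).

Lemma porbit_agree (T : finType) (s t : {perm T}) x :
  {in porbit s x, s =1 t} -> porbit t x = porbit s x.
Proof.
move=> st; have E i : (t ^+ i)%g x = (s ^+ i)%g x.
  elim: i => [|i IHi]; first by rewrite !expg0.
  by rewrite !expgSr !permM IHi st // mem_porbit.
apply/setP => y; apply/porbitP/porbitP => -[i ->]; exists i; by rewrite ?E // -E.
Qed.

Section CycleRemoval.

Variables (T : finType) (C : {set T}) (s1 s2 : {perm T}).
Hypotheses (s1C : perm_on C s1) (s2C : perm_on (~: C) s2).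

Lemma mulpermE_in y : y \in C -> (s1 * s2)%g y = s1 y.
Proof.
by move=> yC; rewrite permM (out_perm s2C) // inE negbK perm_closed.
Qed.

Lemma mulpermE_out y : y \notin C -> (s1 * s2)%g y = s2 y.
Proof. by move=> yC; rewrite permM (out_perm s1C). Qed.

Lemma porbit_sub_on y : y \in C -> porbit s1 y \subset C.
Proof.
move=> yC; apply/subsetP => z /porbitP[i ->].
by elim: i => [|i IHi]; rewrite ?expg0 ?perm1 // expgSr permM perm_closed.
Qed.

Lemma porbit_mul_in y : y \in C -> porbit (s1 * s2)%g y = porbit s1 y.
Proof.
move=> yC; apply: porbit_agree => z /(subsetP (porbit_sub_on yC)) zC.
by rewrite mulpermE_in.
Qed.

(** Orbits are enumerated in no controlled order, so the lists agree only up to permutation; this is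
    why statistics are required to satisfy [perm_eq_fun]. *)
Lemma cycle_sizes_mul (A : {set T}) x : x \in C -> C \subset A ->
  porbit s1 x = C ->
  perm_eq (cycle_sizes A (s1 * s2)%g) (#|C| :: cycle_sizes (A :\: C) s2).
Proof.
move=> xC CA s1x; set s := (s1 * s2)%g.
have sx : porbit s x = C by rewrite porbit_mul_in.
have s2out y : porbit s2 y \subset ~: C -> porbit s y = porbit s2 y.
  move=> yC; apply: porbit_agree => z /(subsetP yC); rewrite inE => zC.
  by rewrite mulpermE_out.
rewrite -[X in perm_eq _ X]/(map (fun D : {set T} => #|D|)
  (C :: enum [set D in porbits s2 | D \subset A :\: C])).
apply: perm_map; apply: uniq_perm; rewrite ?enum_uniq //=.
  rewrite enum_uniq andbT mem_enum inE negb_and; apply/orP; right.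
  by apply/subsetPn; exists x => //; rewrite inE xC.
move=> D; rewrite mem_enum !inE mem_enum inE; apply/andP/orP.
  case=> /imsetP[y _ ->] DA; case: (boolP (y \in C)) => yC.
    by left; move: yC; rewrite -sx eq_porbit_mem.
  have DC : porbit s y \subset ~: C.
    apply/subsetP => z zD; rewrite inE; apply: contraNN yC => zC.
    move: zC zD; rewrite -sx -!eq_porbit_mem => /eqP <- /eqP ->.
    exact: eqxx.
  right; have E : porbit s2 y = porbit s y.
    apply: porbit_agree => z /(subsetP DC); rewrite inE => zC.
    by rewrite mulpermE_out.
  by rewrite -E imset_f //= setDE subsetI E DA.
case=> [/eqP->|/andP[/imsetP[y _ ->]]]; first by rewrite -{1}sx imset_f.
rewrite setDE subsetI => /andP[DA DC]; split=> //.
by rewrite -s2out // imset_f.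
Qed.

End CycleRemoval.

Lemma porbit_stable (T : finType) (s : {perm T}) x : s \in 'N(porbit s x | 'P)%g.
Proof.
apply/astabsP => y; rewrite /= /aperm -!eq_porbit_mem.
by have := porbit_perm s 1 y; rewrite expg1 => ->.
Qed.

Lemma restr_perm_mul (T : finType) (s : {perm T}) (C : {set T}) :
  s \in 'N(C | 'P)%g -> (restr_perm C s * restr_perm (~: C) s)%g = s.
Proof.
move=> sC; have sC' : s \in 'N(~: C | 'P)%g by rewrite astabsC.
apply/permP => y; case: (boolP (y \in C)) => yC.
  rewrite (mulpermE_in (restr_perm_on _ _) (restr_perm_on _ _)) //.
  by rewrite restr_permE.
rewrite (mulpermE_out _ (restr_perm_on _ _)) //.
by rewrite restr_permE // inE.
Qed.

(* The number of cyclic permutations of [C], for [x] in [C]. *)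
Definition ncycles (T : finType) (C : {set T}) (x : T) : nat :=
  #|[set s : {perm T} | perm_on C s & porbit s x == C]|.

Definition cycle_sum (T : finType) (A : {set T}) (Q : seq nat -> rat) : rat :=
  \sum_(s : {perm T} | perm_on A s) Q (cycle_sizes A s).

(** Restriction to C and to its complement, with multiplication as inverse, matches the permutations
    in which x has cycle C with pairs of a cyclic permutation of C and a permutation of the rest. *)
Lemma cycle_sum_fiber (T : finType) (A C : {set T}) x Q :
  perm_eq_fun Q -> x \in C -> C \subset A ->
  \sum_(s : {perm T} | perm_on A s && (porbit s x == C)) Q (cycle_sizes A s) =
  (ncycles C x)%:R * cycle_sum (A :\: C) (fun u => Q (#|C| :: u)).
Proof.
move=> QP xC CA.
rewrite (reindex_onto (fun p : {perm T} * {perm T} => (p.1 * p.2)%g)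
  (fun s => (restr_perm C s, restr_perm (~: C) s))) /=; last first.
  move=> s /andP[_ /eqP sx]; apply: restr_perm_mul.
  by rewrite -sx porbit_stable.
rewrite /ncycles -sum1_card natr_sum mulr_suml /cycle_sum.
under [RHS]eq_bigr => s1 _ do rewrite mul1r.
rewrite pair_big; apply: eq_big => [[s1 s2]|[s1 s2]] /=.
  rewrite inE; apply/andP/andP => -[].
    move=> /andP[onA /eqP sx] /eqP[E1 E2].
    have s1C : perm_on C s1 by rewrite -E1 restr_perm_on.
    have s2C : perm_on (~: C) s2 by rewrite -E2 restr_perm_on.
    rewrite s1C -[X in X == C](porbit_mul_in s1C s2C) // sx eqxx; split=> //.
    apply/subsetP => y ys2; rewrite inE.
    have yC : y \notin C by move/subsetP: s2C => /(_ y ys2); rewrite inE.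
    rewrite yC /=; move/subsetP: onA; apply.
    by rewrite inE (mulpermE_out s2 s1C).
  move=> /andP[s1C /eqP s1x] s2A.
  have s2C : perm_on (~: C) s2.
    by apply: subset_trans s2A _; rewrite setDE subsetIr.
  split.
    rewrite (porbit_mul_in s1C s2C) // s1x eqxx andbT.
    apply: perm_onM; first exact: subset_trans s1C CA.
    by apply: subset_trans s2A _; rewrite subsetDl.
  have sC : (s1 * s2)%g \in 'N(C | 'P)%g.
    by rewrite -[in 'N(C | _)%g]s1x -(porbit_mul_in s1C s2C) // porbit_stable.
  rewrite xpair_eqE; apply/andP; split; apply/eqP/permP => y.
    case: (boolP (y \in C)) => yC.
      by rewrite restr_permE // (mulpermE_in s1C s2C).
    by rewrite !(out_perm _ yC) // restr_perm_on.
  case: (boolP (y \in C)) => yC.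
    by rewrite !(@out_perm _ (~: C)) ?restr_perm_on // inE negbK.
  by rewrite restr_permE ?astabsC ?(mulpermE_out s2 s1C) // inE.
move=> /andP[/andP[_ /eqP sx] /eqP[E1 E2]].
have s1C : perm_on C s1 by rewrite -E1 restr_perm_on.
have s2C : perm_on (~: C) s2 by rewrite -E2 restr_perm_on.
by apply: QP; apply: (cycle_sizes_mul s1C s2C xC CA); rewrite -(porbit_mul_in s1C s2C).
Qed.

Lemma cycle_sum_step (T : finType) (A : {set T}) x Q :
  perm_eq_fun Q -> x \in A ->
  cycle_sum A Q = \sum_(C : {set T} | (x \in C) && (C \subset A))
    (ncycles C x)%:R * cycle_sum (A :\: C) (fun u => Q (#|C| :: u)).
Proof.
move=> QP xA; rewrite /cycle_sum.
rewrite (partition_big (fun s : {perm T} => porbit s x)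
  (fun C => (x \in C) && (C \subset A))) /=; last first.
  by move=> s sA; rewrite porbit_id (porbit_sub_on sA).
by apply: eq_bigr => C /andP[xC CA]; apply: cycle_sum_fiber.
Qed.

Lemma cycle_sum1 (T : finType) (A : {set T}) : cycle_sum A (fun=> 1) = #|A|`!%:R.
Proof.
rewrite -card_perm -sum1_card natr_sum; apply: eq_bigl => s.
by rewrite unfold_in.
Qed.

(** Each c has the same total weight, as binomial(|A|-1, c-1) (c-1)! (|A|-c)! = (|A|-1)!. In other
    words, the length of the cycle through x is uniform. *)
Lemma card_sub_fact (T : finType) (A : {set T}) x (g : nat -> rat) : x \in A ->
  \sum_(C : {set T} | (x \in C) && (C \subset A))
    (#|C|.-1`! * (#|A| - #|C|)`!)%:R * g #|C| =
  #|A|.-1`!%:R * \sum_(1 <= c < #|A|.+1) g c.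
Proof.
move=> xA; have A0 : (0 < #|A|)%N by apply/card_gt0P; exists x.
rewrite (sum_subsets_with (fun c => (c.-1`! * (#|A| - c)`!)%:R * g c) xA).
rewrite mulr_sumr; apply: eq_big_nat => c /andP[c0 cA].
rewrite mulrA -natrM -(@bin_fact #|A|.-1 c.-1); last lia.
by rewrite (_ : #|A|.-1 - c.-1 = #|A| - c)%N //; lia.
Qed.

(* Removing the cycle of x gives |C|! = sum over D of ncycles D x * (|C| - |D|)!,
   a recursion that (|D| - 1)! satisfies too. *)
Lemma ncyclesE (T : finType) (C : {set T}) x : x \in C -> ncycles C x = #|C|.-1`!.
Proof.
have [n] := ubnP #|C|; elim: n C => // n IHn C Cn xC.
have C0 : (0 < #|C|)%N by apply/card_gt0P; exists x.
have QP : perm_eq_fun (fun=> 1) by [].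
have := cycle_sum_step QP xC; rewrite cycle_sum1.
have := @card_sub_fact _ C x (fun=> 1) xC.
rewrite sumr_const_nat subn1 /= mulr_natr -mulrnA mulnC -[X in (X * _)%N](prednK C0).
rewrite -factS prednK // => <-; rewrite (bigD1 C) ?xC //=.
rewrite [X in _ = X -> _](bigD1 C) ?xC //=.
(* By induction the two sums agree at every proper subset D, so the terms at D = C agree as well. *)
rewrite (eq_bigr (fun D => (ncycles D x)%:R * cycle_sum (C :\: D) (fun=> 1))).
  move/addIr; rewrite cycle_sum1 setDv cards0 subnn fact0 muln1 !mulr1.
  by move=> /eqP; rewrite eqr_nat eq_sym => /eqP.
move=> D /andP[/andP[xD DC] nDC].
rewrite cycle_sum1 cardsD (setIidPr DC) IHn ?mulr1 -?natrM //.
apply: leq_trans (proper_card _) _; last by rewrite -ltnS; exact: Cn.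
by rewrite properEneq nDC.
Qed.

(** Removing the cycle of a point, whose length is uniform by [card_sub_fact], gives the left side
    the recursion [cmean_step]. *)
Lemma cycle_sumE (T : finType) (A : {set T}) Q :
  perm_eq_fun Q -> cycle_sum A Q = #|A|`!%:R * cmean #|A| Q.
Proof.
have [n] := ubnP #|A|; elim: n A Q => // n IHn A Q An QP.
case: (set_0Vmem A) => [->|[x xA]].
  rewrite cards0 cmean0 fact0 mul1r /cycle_sum (big_pred1 1%g) => [|s].
    rewrite /cycle_sizes (_ : finset _ = set0) ?enum_set0 //.
    apply/setP => D; rewrite !inE subset0; apply/andP => -[/imsetP[y _ ->]].
    by move/eqP/setP/(_ y); rewrite porbit_id inE.
  apply/idP/eqP => [s0|->]; last exact: perm_on1.
  by apply/permP => y; rewrite perm1 (out_perm s0) // inE.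
have A0 : (0 < #|A|)%N by apply/card_gt0P; exists x.
rewrite (cycle_sum_step QP xA).
rewrite (eq_bigr (fun C : {set T} => (#|C|.-1`! * (#|A| - #|C|)`!)%:R *
   cmean (#|A| - #|C|) (fun u => Q (#|C| :: u)))).
  rewrite (card_sub_fact (fun c => cmean (#|A| - c) (fun u => Q (c :: u))) xA).
  by rewrite -cmean_step // mulrA -natrM mulnC -{1}(prednK A0) -factS prednK.
move=> C /andP[xC CA]; rewrite ncyclesE // IHn; last exact: perm_eq_fun_cons.
  by rewrite cardsD (setIidPr CA) mulrA -natrM.
rewrite ltnS in An; apply: leq_trans An; rewrite cardsD (setIidPr CA).
have C0 : (0 < #|C|)%N by apply/card_gt0P; exists x.
by rewrite ltn_subrL C0.
Qed.

Local Close Scope ring_scope.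

(** * Permutations with a root *)

Section PermOrbits.

Variable T : finType.
Implicit Types (s t : {perm T}) (x y : T).

Lemma card_porbit_gt0 s x : 0 < #|porbit s x|.
Proof. by rewrite lt0n card_porbit_neq0. Qed.

Lemma expg_porbit_fix s x i : ((s ^+ i)%g x == x) = (#|porbit s x| %| i).
Proof.
have c0 := card_porbit_gt0 s x; set c := #|_| in c0 *.
have E : (s ^+ i)%g x = (s ^+ (i %% c))%g x.
  rewrite {1}(divn_eq i c) mulnC expgD expgM permM; congr ((_ : {perm T}) _).
  elim: (i %/ c) => [|k IHk]; first by rewrite expg0 perm1.
  by rewrite expgSr permM IHk permX iter_porbit.
have ic : i %% c < c by rewrite ltn_mod.
rewrite E /dvdn; apply/eqP/eqP => [|->]; last by rewrite expg0 perm1.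
rewrite permX => sx; apply/eqP; move: (uniq_traject_porbit s x).
move/(nth_uniq x) => /(_ (i %% c) 0); rewrite size_traject => <- //.
by rewrite !nth_traject //= sx.
Qed.

Lemma expg_porbit_eq s x i j :
  ((s ^+ i)%g x == (s ^+ j)%g x) = (i == j %[mod #|porbit s x|]).
Proof.
wlog ij : i j / i <= j.
  move=> H; case: (leqP i j) => [/H //|/ltnW /H E].
  by rewrite eq_sym E eq_sym.
rewrite eq_sym -[in LHS](subnK ij) expgD permM (inj_eq perm_inj).
by rewrite expg_porbit_fix [RHS]eq_sym eqn_mod_dvd.
Qed.

Lemma card_porbit_commute s t x : commute s t -> #|porbit s (t x)| = #|porbit s x|.
Proof.
move=> st; apply/eqP; rewrite eqn_dvd -!expg_porbit_fix.
have E i : (s ^+ i)%g (t x) = t ((s ^+ i)%g x).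
  by rewrite -!permM (commuteX _ (commute_sym st)).
rewrite E (inj_eq perm_inj) expg_porbit_fix dvdnn /=.
by rewrite -(inj_eq (@perm_inj _ t)) -E expg_porbit_fix.
Qed.

Lemma card_stable_porbits s (D : {set T}) k :
  {in D, forall x, s x \in D} -> {in D, forall x, #|porbit s x| = k} ->
  #|D| = k * #|porbit s @: D|.
Proof.
move=> sD kD; rewrite -sum1_card (partition_big_imset (porbit s)) /=.
rewrite (eq_bigr (fun=> k)) ?sum_nat_const 1?mulnC // => C /imsetP[x xD ->].
rewrite -(kD x xD) -[RHS]sum1_card; apply: eq_bigl => y.
rewrite eq_porbit_mem andb_idl // => /porbitP[i ->].
by elim: i => [|i IHi]; rewrite ?expg0 ?perm1 // expgSr permM sD.
Qed.

Definition length_set s c : {set T} := [set x | #|porbit s x| == c].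

Lemma porbit_length_set s c :
  porbit s @: length_set s c = [set C in porbits s | #|C| == c].
Proof.
apply/setP => C; rewrite inE; apply/imsetP/andP => [[x]|[/imsetP[x _ ->] xc]].
  by rewrite inE => xc ->; rewrite imset_f.
by exists x; rewrite ?inE.
Qed.

Lemma card_length_set s c : #|length_set s c| = c * #|[set C in porbits s | #|C| == c]|.
Proof.
rewrite -porbit_length_set; apply: card_stable_porbits => x; rewrite !inE.
  by rewrite card_porbit_commute.
by move/eqP.
Qed.

Lemma count_cycle_sizes s c :
  count_mem c (cycle_sizes setT s) = #|[set C in porbits s | #|C| == c]|.
Proof.
rewrite /cycle_sizes count_map -size_filter cardE.
apply/perm_size/uniq_perm => [||C]; [exact/filter_uniq/enum_uniq|exact: enum_uniq|].
by rewrite mem_filter !mem_enum !inE subsetT andbT andbC.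
Qed.

(** A t-cycle of length k splits into g = gcd(k, q^l) cycles of length c = k/g, where g = q^i. If i
    < l, then q dividing c would make q^(i+1) a common divisor of k and q^l. *)
Lemma porbit_expg_length q l s t x : prime q -> (t ^+ (q ^ l))%g = s ->
  q %| #|porbit s x| -> #|porbit t x| = #|porbit s x| * q ^ l.
Proof.
move=> pq <-; set c := #|porbit (t ^+ _)%g x|; set k := #|porbit t x| => qc.
have E i : (c %| i) = (k %| q ^ l * i).
  by rewrite /c /k -!expg_porbit_fix -expgM.
have c0 : 0 < c by apply: card_porbit_gt0.
have k0 : 0 < k by apply: card_porbit_gt0.
have kc : k %| q ^ l * c by rewrite -E.
have [i il gE] : exists2 i, i <= l & gcdn k (q ^ l) = q ^ i.
  by apply/(dvdn_pfactor _ _ pq); apply: dvdn_gcdr.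
have g0 : 0 < gcdn k (q ^ l) by rewrite gcdn_gt0 k0.
have kE : k = c * q ^ i.
  have kg := divnK (dvdn_gcdl k (q ^ l)).
  rewrite -[LHS]kg gE; congr (_ * _); rewrite -gE.
  apply/eqP; rewrite eqn_dvd E; apply/andP; split.
    have co : coprime (k %/ gcdn k (q ^ l)) (q ^ l %/ gcdn k (q ^ l)).
      rewrite /coprime -(eqn_pmul2r g0) mul1n muln_gcdl kg.
      by rewrite (divnK (dvdn_gcdr _ _)).
    rewrite -(Gauss_dvdr _ co) -(dvdn_pmul2r g0) kg mulnAC.
    by rewrite (divnK (dvdn_gcdr _ _)).
  rewrite -{1}kg mulnC dvdn_mul // dvdn_gcdr.
  by [].
suff il2 : l <= i by rewrite kE (@anti_leq i l) // il.
rewrite leqNgt; apply/negP => ltil.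
have : q ^ i.+1 %| q ^ i.
  by rewrite -[X in _ %| X]gE dvdn_gcd kE expnS dvdn_mul //= -expnS dvdn_exp2l.
by rewrite dvdn_Pexp2l ?prime_gt1 // ltnn.
Qed.

(** The root t permutes the points on c-cycles of s, in cycles of length c q^l; so c q^l divides
    their number, which is c times the number of c-cycles. *)
Lemma root_count q l s t c : prime q -> (t ^+ (q ^ l))%g = s ->
  q %| c -> q ^ l %| #|[set C in porbits s | #|C| == c]|.
Proof.
move=> pq ts qc; case: (posnP c) => [->|c0].
  rewrite (_ : finset _ = set0) ?cards0 //; apply/setP => C; rewrite !inE.
  apply/andP => -[/imsetP[x _ ->]]; exact/negP/card_porbit_neq0.
rewrite -(dvdn_pmul2l c0) -card_length_set.
rewrite (@card_stable_porbits t _ (c * q ^ l)); first exact: dvdn_mulr.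
  move=> x; rewrite !inE.
  rewrite card_porbit_commute // -ts; exact/commute_sym/commuteX.
by move=> x; rewrite inE => /eqP xc; rewrite (porbit_expg_length pq ts) xc.
Qed.

End PermOrbits.

(** * Construction of roots, one cycle length at a time *)

Section Roots.

Variable T : finType.
Implicit Types (s t : {perm T}) (x y : T).

(** The power s^e with e r = 1 mod c is a root on the c-cycles. *)
Lemma coprime_length_root s r c : 0 < c -> coprime c r ->
  exists f : {ffun T -> T}, {in length_set s c, forall x,
    f x \in length_set s c /\ iter r f x = s x}.
Proof.
(* For r = 0, coprimality forces c = 1, and the points concerned are fixed by s. *)
move=> c0 co; case: (posnP r) => [r0|r0].
  have c1 : c = 1 by move: co; rewrite r0 /coprime gcdn0 => /eqP.
  exists [ffun x => x] => x; rewrite ffunE inE c1 r0 => x1; split=> //=.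
  by have := expg_porbit_fix s x 1; rewrite (eqP x1) expg1 => /eqP.
case: (@egcdnP r c r0) => e k ek _.
have cs x i : ((s ^+ i)%g x \in length_set s c) = (x \in length_set s c).
  by rewrite !inE porbit_perm.
exists [ffun x => (s ^+ e)%g x] => x xc; rewrite ffunE cs; split=> //.
have -> : iter r [ffun x => (s ^+ e)%g x] x = (s ^+ (e * r))%g x.
  elim: r {r0 ek co} => [|r IHr] /=; first by rewrite muln0 expg0 perm1.
  by rewrite IHr ffunE -permM -expgD mulnS addnC.
rewrite ek gcdnC (eqP co) -[in RHS](expg1 s); apply/eqP; rewrite expg_porbit_eq.
by move: xc; rewrite inE => /eqP ->; rewrite modnMDl.
Qed.

(* The c-cycles are grouped into blocks of r; with base points R k, the root maps
   s^a (R k) to s^a (R k.+1) inside a block, and from the last cycle of a block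
   to s^(a+1) of the first base point. *)
Lemma blocks_root s r c : 0 < c -> 0 < r ->
  r %| #|[set C in porbits s | #|C| == c]| ->
  exists f : {ffun T -> T}, {in length_set s c, forall x,
    f x \in length_set s c /\ iter r f x = s x}.
Proof.
move=> c0 r0; case: (set_0Vmem (length_set s c)) => [-> _|[x0 x0c]].
  by exists [ffun x => x] => x; rewrite inE.
set L := enum [set C in porbits s | #|C| == c].
rewrite cardE -/L => /dvdnP[M LM].
(* The default [x0] is never taken for k < [size L], orbits being nonempty. *)
pose R k := odflt x0 [pick z in nth set0 L k].
have RP k : k < size L -> porbit s (R k) = nth set0 L k.
  move=> kL; have := mem_nth set0 kL; rewrite mem_enum inE => /andP[/imsetP[y _ Ly] _].
  rewrite /R; case: pickP => [z|/(_ y)]; rewrite Ly; last by rewrite porbit_id.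
  by move=> zy; apply/eqP; rewrite eq_porbit_mem.
have Rc k : k < size L -> #|porbit s (R k)| = c.
  move=> kL; have := mem_nth set0 kL; rewrite RP // mem_enum inE.
  by case/andP => _ /eqP.
pose K x := index (porbit s x) L.
have KP x : x \in length_set s c -> K x < size L /\ porbit s (R (K x)) = porbit s x.
  rewrite inE => xc; have xL : porbit s x \in L by rewrite mem_enum !inE imset_f.
  have KL : K x < size L by rewrite index_mem.
  by split=> //; rewrite RP // nth_index.
have KR k a : k < size L -> K ((s ^+ a)%g (R k)) = k.
  by move=> kL; rewrite /K porbit_perm RP // index_uniq // enum_uniq.
pose A x := index x (traject s (R (K x)) c).
have AP x : x \in length_set s c -> (s ^+ A x)%g (R (K x)) = x.
  move=> xc; have [KL KE] := KP x xc.
  have xt : x \in traject s (R (K x)) c.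
    by rewrite -(Rc _ KL) -porbit_traject KE porbit_id.
  have AL : A x < c by rewrite -[X in _ < X](size_traject s (R (K x)) c) index_mem.
  by rewrite permX -(nth_traject s AL (R (K x))) nth_index.
pose nxt k := if k %% r == r.-1 then k - r.-1 else k.+1.
pose f := [ffun x => (s ^+ (A x + (K x %% r == r.-1)))%g (R (nxt (K x)))].
have nxtL k : k < size L -> nxt k < size L.
  move=> kL; rewrite /nxt; case: eqP => kr; first exact: leq_ltn_trans (leq_subr _ _) kL.
  rewrite LM (divn_eq k r) -addnS.
  have kM : k %/ r < M by rewrite ltn_divLR // -LM.
  have : k %% r < r by rewrite ltn_mod.
  by nia.
have Rin k a : k < size L -> (s ^+ a)%g (R k) \in length_set s c.
  by move=> kL; rewrite inE porbit_perm Rc.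
(* The index [A] recovers a only modulo c, which suffices because the target cycle has length c
   too. *)
have fE k a : k < size L ->
    f ((s ^+ a)%g (R k)) = (s ^+ (a + (k %% r == r.-1)))%g (R (nxt k)).
  move=> kL; rewrite ffunE KR //; apply/eqP; rewrite expg_porbit_eq Rc ?nxtL //.
  rewrite eqn_modDr -[X in _ == _ %[mod X]](Rc k kL) -expg_porbit_eq.
  by have := AP _ (Rin k a kL); rewrite KR // => ->.
exists f => x xc; have [KL KE] := KP x xc.
rewrite -(AP x xc) fE //; split; first exact/Rin/nxtL.
set k := K x in KL *; set a := A x; set g := k %/ r * r.
have kE : k = g + k %% r by rewrite /g -divn_eq.
have gr i : i < r -> (g + i) %% r = i by move=> ir; rewrite modnMDl modn_small.
have gL i : i < r -> g + i < size L.
  have : k %/ r < M by rewrite ltn_divLR // -LM.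
  by rewrite /g LM; nia.
have fI i b : i < r -> iter i f ((s ^+ b)%g (R g)) = (s ^+ b)%g (R (g + i)).
  elim: i => [|i IHi] ir; first by rewrite addn0.
  rewrite iterS IHi 1?ltnW // fE ?gL 1?ltnW // gr 1?ltnW //.
  have ir1 : (i == r.-1) = false by lia.
  by rewrite ir1 addn0 /nxt gr 1?ltnW // ir1 addnS.
have fr b : iter r f ((s ^+ b)%g (R g)) = (s ^+ b.+1)%g (R g).
  rewrite -{1}(prednK r0) iterS fI ?ltn_predL // fE ?gL ?ltn_predL //.
  by rewrite gr ?ltn_predL // eqxx addn1 /nxt gr ?ltn_predL // eqxx addnK.
have kr : k %% r < r by rewrite ltn_mod.
(* The point is reached from the first cycle of its block by k mod r applications of f; these
   commute with f^r, so f^r is needed on that first cycle only. *)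
rewrite kE -fI // -iterD addnC iterD fr !fI //.
by rewrite expgSr permM.
Qed.

(** The partial maps preserve their length sets, so they glue to a map f with f^r = s; f is
    injective because s is and r > 0. *)
Lemma glue_root s r :
  (forall c, 0 < c -> exists f : {ffun T -> T}, {in length_set s c, forall x,
    f x \in length_set s c /\ iter r f x = s x}) ->
  0 < r -> exists t : {perm T}, (t ^+ r)%g = s.
Proof.
move=> H r0.
(* Lengths are bounded by the number of points, so the choice of maps is finite; length 0 never
   occurs. *)
have {}H (c : 'I_#|T|.+1) : exists f : {ffun T -> T},
    {in length_set s c, forall x, f x \in length_set s c /\ iter r f x = s x}.
  case: (posnP c) => [->|c0]; last exact: H.
  by exists [ffun x => x] => x; rewrite inE (negbTE (card_porbit_neq0 _ _)).
have [F FP] := fin_all_exists H.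
pose len x : 'I_#|T|.+1 := inord #|porbit s x|.
have lenP x c : (x \in length_set s c) -> len x = c :> nat.
  by rewrite inE => /eqP <-; rewrite /len inordK // ltnS max_card.
have lenI x : x \in length_set s (len x).
  by rewrite inE /len inordK // ltnS max_card.
pose f x := F (len x) x.
have fiter x : iter r f x = s x.
  rewrite -(proj2 (FP _ _ (lenI x))); move: (lenI x); set c := len x => xc.
  have /(_ r)[] // : forall i, iter i f x = iter i (F c) x /\
    iter i (F c) x \in length_set s c.
  elim=> [|i [IHi ic]] //=; rewrite IHi /f (val_inj (lenP _ _ ic)).
  by have [] := FP c _ ic.
have finj : injective f.
  move=> x y xy; apply: (@perm_inj _ s); rewrite -!fiter -(prednK r0) !iterSr xy.
  by [].
exists (perm finj); apply/permP => x; rewrite permX -fiter.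
by apply: eq_iter => y; rewrite permE.
Qed.

End Roots.

(** * The root criterion and the monotonicity *)

Lemma has_rootE q l n (s : 'S_n) : prime q ->
  has_root (q ^ l) s = rooted q (q ^ l) (cycle_sizes setT s).
Proof.
move=> pq; have r0 : 0 < q ^ l by rewrite expn_gt0 prime_gt0.
apply/existsP/allP => [[t /eqP ts] c _|H].
  by apply/implyP => qc; rewrite count_cycle_sizes (root_count pq ts).
have [|t ts] := @glue_root _ s (q ^ l) _ r0; last by exists t; apply/eqP.
move=> c c0; case: (boolP (q %| c)) => qc.
  apply: blocks_root => //; rewrite -count_cycle_sizes.
  case: (boolP (c \in cycle_sizes setT s)) => [/H|/count_memPn ->].
    by rewrite qc.
  exact: dvdn0.
by apply: coprime_length_root => //; rewrite coprimeXr // coprime_sym prime_coprime.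
Qed.

Lemma root_probE q l n : prime q ->
  root_prob (q ^ l) n = cmean n (fun u => (rooted q (q ^ l) u)%:R%R).
Proof.
move=> pq; have QP : perm_eq_fun (fun u => (rooted q (q ^ l) u)%:R%R).
  by move=> u v /rooted_perm ->.
have := cycle_sumE [set: 'I_n] QP; rewrite cardsT card_ord /root_prob => E.
have nz : (n`!%:R != 0 :> rat)%R by rewrite pnatr_eq0 -lt0n fact_gt0.
apply: (mulfI nz); rewrite -E mulrCA divff // mulr1.
rewrite -sum1_card natr_sum big_mkcond /cycle_sum.
apply: eq_big => [s|s _]; first by apply/esym/subsetP => i; rewrite inE.
by rewrite inE (has_rootE _ _ pq); case: rooted.
Qed.

Theorem theorem4p1 (n q l : nat) (hn : (0 < n)%N) (hq : prime q)
    (hl : (1 <= l)%N) :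
  (root_prob (q ^ l)%N n >= root_prob (q ^ l)%N n.+1)%R.
Proof.
have r0 : 0 < q ^ l by rewrite expn_gt0 prime_gt0.
have qr : q %| q ^ l by rewrite dvdn_exp.
by rewrite !root_probE // cmean_rooted_le ?prime_gt1.
Qed.
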